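(* Let $L\subset\mathbb{Z}^n$ be a lattice. If $\operatorname{rank}(L_{pure})>1$, or $\operatorname{rank}(L_{pure})=1$ and $L\ne L_{pure}$, then the universal Markov basis of $I_L$ is infinite.
   Context: Let $\Bbbk$ be a field, $\mathbb{N}=\mathbb{Z}_{\ge0}$. A lattice is a subgroup $L\subset\mathbb{Z}^n$; its lattice ideal is $I_L=\langle x^u-x^v:u,v\in\mathbb{N}^n,\ u-v\in L\rangle\subset\Bbbk[x_1,\ldots,x_n]$. $L_{pure}$ is the subgroup of $L$ generated by $L\cap\mathbb{N}^n$. A binomial means a difference $x^u-x^v$ of two distinct monomials. A minimal generating set of $I_L$ is a set of binomials that is a minimal (under inclusion) system of generators of $I_L$; it is a cardinality-minimal generating set if it has the least cardinality among all minimal generating sets. The universal Markov basis of $I_L$ is the union of all cardinality-minimal generating sets of $I_L$, with binomials identified up to sign. *)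

(* Defs.v *)
From HB Require Import structures.
From mathcomp Require Import all_boot all_order all_algebra.
From mathcomp Require Import boolp classical_sets cardinality.
From mathcomp Require Import mpoly.

Set Implicit Arguments.
Unset Strict Implicit.
Unset Printing Implicit Defensive.

Import Order.TTheory GRing.Theory Num.Theory.
Local Open Scope classical_set_scope.
Local Open Scope ring_scope.
Local Open Scope card_scope.

Definition is_lattice (n : nat) (L : set 'rV[int]_n) : Prop :=
  zmod_closed (mem L).

Definition pure_part (n : nat) (L : set 'rV[int]_n) : set 'rV[int]_n :=
  smallest (@is_lattice n) (L `&` [set v | forall i, 0 <= v ord0 i]).

(* The largest number of Q-linearly independent vectors in M; this number is
   at most n, so bounding the maximum by r < n.+1 loses nothing. *)
Definition lattice_rank (n : nat) (M : set 'rV[int]_n) : nat :=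
  (\max_(r < n.+1 | `[< exists B : 'M[int]_(r, n),
      (forall i, M (row i B)) /\
      row_free (map_mx (intr : int -> rat) B) >]) r)%N.

Definition exponent_diff (n : nat) (u v : 'X_{1..n}) : 'rV[int]_n :=
  \row_i ((u i)%:Z - (v i)%:Z).

Section Ideals.
Variables (k : fieldType) (n : nat).
Implicit Types (S T : set {mpoly k[n]}) (L : set 'rV[int]_n).

(* The library's idealr_closed excludes the unit ideal. *)
Definition is_ideal S : Prop :=
  [/\ S 0, forall f g, S f -> S g -> S (f + g)
    & forall f g, S g -> S (f * g)].

Definition ideal_of S : set {mpoly k[n]} := smallest is_ideal S.

Definition lattice_ideal L : set {mpoly k[n]} :=
  ideal_of [set f | exists u v : 'X_{1..n},
    L (exponent_diff u v) /\ f = 'X_[u] - 'X_[v]].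

Definition binomials : set {mpoly k[n]} :=
  [set f | exists u v : 'X_{1..n}, u <> v /\ f = 'X_[u] - 'X_[v]].

Definition minimal_generating_set L S : Prop :=
  [/\ S `<=` binomials, ideal_of S = lattice_ideal L
    & forall T, T `<=` S -> ideal_of T = lattice_ideal L -> T = S].

Definition cardinality_minimal L S : Prop :=
  minimal_generating_set L S /\
  (forall T, minimal_generating_set L T -> S #<= T).

(* An element is a pair {f, -f}: a binomial identified up to sign. *)
Definition universal_markov_basis L : set (set {mpoly k[n]}) :=
  [set [set f; - f] | f in \bigcup_(S in cardinality_minimal L) S].

End Ideals.

Arguments universal_markov_basis k {n} L.

(* Main.v *)
Require Import Defs.
From mathcomp Require Import all_boot all_order all_algebra.
From mathcomp Require Import boolp classical_sets cardinality.
From mathcomp Require Import mpoly ring.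

Set Implicit Arguments.
Unset Strict Implicit.
Unset Printing Implicit Defensive.

Import Order.TTheory GRing.Theory Num.Theory.
Local Open Scope classical_set_scope.
Local Open Scope ring_scope.
Local Open Scope card_scope.

(** Since the pure part has positive rank, [L] contains a nonzero vector [w0] of
    the orthant ([pure_part_nonzero]), and [1 - X^w0] lies in the ideal.
    This polynomial has constant term 1, so no system of binomials without a
    constant term can generate it: every binomial generating set [S] contains
    some [g = 1 - X^w] or [g = X^w - 1] with [w <> 0]
    ([generates_unit_binomial]).  Modulo [g] the monomials [X^a] and
    [X^(a + j w)] agree for all [j].  Hence any other element [X^a - X^b] of
    [S] may be exchanged for [X^(a + j w) - X^b], for every [j], without
    changing the number of generators, and when [S] has the least possible
    size this yields infinitely many elements of the universal Markov basis
    ([shortest_infinite]).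

    It remains to exclude [S = {g}].  The binomials [X^u - X^v] in the ideal
    generated by the binomials of a lattice [M] are those with [u - v] in [M]
    ([lattice_ideal_exponent_diff]).  With [M = Z w], a principal ideal [<g>]
    forces [L = Z w], a lattice of rank one equal to its pure part
    ([principal_lattice_ideal], [lattice_rank_multiples],
    [pure_part_cyclic]), against the hypothesis.

    Sets of least cardinality exist because the ideal is generated by finitely
    many binomials ([lattice_ideal_fg]), which follows from Dickson's lemma
    for pairs of exponents. *)

(** * Well-quasi-orders *)

(** The subsequence visits indices [i] at which [f] attains its minimum over
    all indices [j >= i]; such indices occur beyond any bound. *)
Lemma nondecreasing_subsequence (f : nat -> nat) :
  exists2 phi : nat -> nat, {homo phi : i j / (i < j)%N}
    & forall i j, (i <= j)%N -> (f (phi i) <= f (phi j))%N.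
Proof.
have low N : exists i, (N <= i)%N /\ forall j, (N <= j)%N -> (f i <= f j)%N.
  have ex : exists m, `[< exists2 i, (N <= i)%N & f i = m >].
    by exists (f N); apply/asboolP; exists N.
  case: (ex_minnP ex) => m /asboolP[i leNi fi] min_m.
  exists i; split=> // j leNj.
  by rewrite fi; apply: min_m; apply/asboolP; exists j.
have [c cP] := choice low.
pose phi := fix phi k := if k is k'.+1 then c (phi k').+1 else c 0.
have phiS k : (phi k < phi k.+1)%N by have [] := cP (phi k).+1.
have phi_min k j : (phi k <= j)%N -> (f (phi k) <= f j)%N.
  case: k => [|k] le_kj; first by have [_] := cP 0; apply.
  have [ge_c min_c] := cP (phi k).+1.
  exact: (min_c _ (leq_trans ge_c le_kj)).
exists phi; first exact: (homo_ltn ltn_trans phiS).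
move=> i j le_ij; apply: phi_min.
by apply: (homo_leq leqnn leq_trans) le_ij => k; apply: ltnW.
Qed.

Lemma simultaneous_nondecreasing_subsequence (T : Type) (fs : seq (T -> nat))
    (x : nat -> T) :
  exists2 phi : nat -> nat, {homo phi : i j / (i < j)%N}
    & forall i j, (i <= j)%N ->
        all (fun f => f (x (phi i)) <= f (x (phi j)))%N fs.
Proof.
elim: fs => [|f fs [phi phi_incr phiP]]; first by exists id.
have [psi psi_incr psiP] := nondecreasing_subsequence (f \o x \o phi).
exists (phi \o psi) => [i j lt_ij|i j le_ij /=]; first exact/phi_incr/psi_incr.
rewrite (psiP _ _ le_ij) /=; apply: phiP.
move: le_ij; rewrite leq_eqVlt => /predU1P[->//|lt_ij].
exact/ltnW/psi_incr.
Qed.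

(** If no finite part of [G] dominated [G] from below, choosing again and again
    an element of [G] above none of the previous ones would produce a bad
    sequence. *)
Lemma finite_basis (T : eqType) (R : T -> T -> Prop) (G : set T) :
    (forall x : nat -> T, exists i j, (i < j)%N /\ R (x i) (x j)) ->
  exists s : seq T, (forall q, q \in s -> G q) /\
    forall p, G p -> exists2 q, q \in s & R q p.
Proof.
move=> wqo; apply: contrapT => no_basis.
have next (s : seq T) : exists p, (forall q, q \in s -> G q) ->
    G p /\ forall q, q \in s -> ~ R q p.
  have [sG|nsG] := pselect (forall q, q \in s -> G q).
    apply: contrapT => no_p; apply: no_basis; exists s; split=> // p Gp.
    apply: contrapT => no_q; apply: no_p; exists p => _; split=> // q qs Rqp.
    by apply: no_q; exists q.
  have [x _] : exists x : T, True.
    apply: contrapT => no_x; apply: nsG => q _.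
    by case: no_x; exists q.
  by exists x.
have [F FP] := choice next.
pose st := fix st k := if k is k'.+1 then F (st k') :: st k' else [::].
have stG k : forall q, q \in (st k) -> G q.
  elim: k => [//|k IHk] q /=; rewrite inE => /predU1P[->|]; last exact: IHk.
  by have [] := FP _ IHk.
have st_mem i j : (i < j)%N -> (F (st i)) \in (st j).
  elim: j => [//|j IHj]; rewrite ltnS leq_eqVlt inE => /predU1P[->|lt_ij].
    by rewrite eqxx.
  by rewrite IHj ?orbT.
have [i [j [lt_ij Rij]]] := wqo (F \o st).
have [_ notR] := FP _ (stG j).
exact: notR (st_mem _ _ lt_ij) Rij.
Qed.

Definition le_multinom2 n (p q : 'X_{1..n} * 'X_{1..n}) : bool :=
  (p.1 <= q.1)%MM && (p.2 <= q.2)%MM.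

Lemma dickson_multinom2 n (x : nat -> 'X_{1..n} * 'X_{1..n}) :
  exists i j, (i < j)%N /\ le_multinom2 (x i) (x j).
Proof.
pose coordinates : seq ('X_{1..n} * 'X_{1..n} -> nat) :=
  [seq fun p : 'X_{1..n} * 'X_{1..n} => p.1 i | i <- enum 'I_n] ++
  [seq fun p : 'X_{1..n} * 'X_{1..n} => p.2 i | i <- enum 'I_n].
have [phi phi_incr phiP] :=
  simultaneous_nondecreasing_subsequence coordinates x.
exists (phi 0%N), (phi 1%N); split; first exact: phi_incr.
move: (phiP 0%N 1%N isT); rewrite all_cat all_map [X in _ && X]all_map.
case/andP=> /allP le1 /allP le2.
have i_enum (i : 'I_n) : i \in enum 'I_n by rewrite mem_enum.
apply/andP; split; apply/mnm_lepP => i; first exact: le1 i (i_enum i).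
exact: le2 i (i_enum i).
Qed.

(** * Cardinality of sequences *)

Lemma card_seq_le (T : eqType) (s : seq T) : [set` s] #<= `I_(size s).
Proof.
case: s => [|x s]; first by rewrite set_nil; apply: card_ge0.
have -> : [set` x :: s] = nth x (x :: s) @` `I_(size (x :: s)).
  apply/seteqP; split=> [z /= zs|_ /= [i lt_i <-]]; last exact: mem_nth.
  by exists (index z (x :: s)); [rewrite index_mem|rewrite nth_index].
exact: card_image_le.
Qed.

Lemma card_seq_ge (T : eqType) (s : seq T) : uniq s -> `I_(size s) #<= [set` s].
Proof.
case: s => [_|x s s_uniq]; first by rewrite II0; apply: card_ge0.
have inj_nth : {in `I_(size (x :: s)) &, injective (nth x (x :: s))}.
  by move=> i j; rewrite !in_setE => lt_i lt_j /eqP;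
     rewrite nth_uniq // => /eqP.
rewrite -(card_le_eql (inj_card_eq inj_nth)).
by apply: subset_card_le => _ [i lt_i <-] /=; apply: mem_nth.
Qed.

(** * Ideals *)

Section IdealTheory.
Variables (k : fieldType) (n : nat).
Implicit Types (S T : set {mpoly k[n]}) (f g : {mpoly k[n]}).
Implicit Types (u v w : 'X_{1..n}).

Lemma ideal_of_is_ideal S : is_ideal (ideal_of S).
Proof.
split=> [I [[I0 _ _] _] //|f g Sf Sg I iI|f g Sg I iI].
  by have [[_ addI _] _] := iI; apply: addI; [apply: Sf|apply: Sg].
by have [[_ _ mulI] _] := iI; apply: mulI; apply: Sg.
Qed.

Lemma ideal_of_gen S f : S f -> ideal_of S f.
Proof. exact: sub_gen_smallest. Qed.

Lemma ideal_of0 S : ideal_of S 0.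
Proof. by have [] := ideal_of_is_ideal S. Qed.

Lemma ideal_ofD S f g : ideal_of S f -> ideal_of S g -> ideal_of S (f + g).
Proof. by have [_ addI _] := ideal_of_is_ideal S; apply: addI. Qed.

Lemma ideal_ofMl S f g : ideal_of S g -> ideal_of S (f * g).
Proof. by have [_ _ mulI] := ideal_of_is_ideal S; apply: mulI. Qed.

Lemma ideal_ofN S f : ideal_of S f -> ideal_of S (- f).
Proof. by rewrite -mulN1r; apply: ideal_ofMl. Qed.

Lemma ideal_ofB S f g : ideal_of S f -> ideal_of S g -> ideal_of S (f - g).
Proof. by move=> Sf Sg; apply: ideal_ofD => //; apply: ideal_ofN. Qed.

Lemma ideal_of_min S (I : set {mpoly k[n]}) :
  is_ideal I -> S `<=` I -> ideal_of S `<=` I.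
Proof. exact: smallest_sub. Qed.

Lemma ideal_of_sub S T : S `<=` ideal_of T -> ideal_of S `<=` ideal_of T.
Proof. by apply: ideal_of_min; apply: ideal_of_is_ideal. Qed.

Lemma ideal_of_eq S T :
  S `<=` ideal_of T -> T `<=` ideal_of S -> ideal_of S = ideal_of T.
Proof. by move=> ST TS; apply/seteqP; split; apply: ideal_of_sub. Qed.

(** Taking the constant term is a ring morphism, so its kernel is an ideal. *)
Lemma constant_term_ideal_of S f :
  (forall g, S g -> g@_0%MM = 0) -> ideal_of S f -> f@_0%MM = 0.
Proof.
move=> S0; suff : ideal_of S `<=` [set g | g@_0%MM = 0] by move=> sub /sub.
apply: ideal_of_min => [|//]; split=> /=.
- exact: mcoeff0.
- by move=> p q p0 q0; rewrite mcoeffD p0 q0 addr0.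
- by move=> p q q0; rewrite rmorphM /= q0 mulr0.
Qed.

(** [X^w] is congruent to 1, hence so are all its powers; the difference
    telescopes. *)
Lemma ideal_of_translate S a w j :
  ideal_of S (1 - 'X_[w]) -> ideal_of S ('X_[a] - 'X_[a + w *+ j]).
Proof.
move=> Sw; elim: j => [|j IHj].
  by rewrite mulm0n addm0 subrr; apply: ideal_of0.
have -> : 'X_[a] - 'X_[a + w *+ j.+1] =
    'X_[a] - 'X_[a + w *+ j] + 'X_[a + w *+ j] * (1 - 'X_[w]) :> {mpoly k[n]}.
  by rewrite mulrBr mulr1 -mpolyXD -addmA -mulmSr addrA subrK.
by apply: ideal_ofD => //; apply: ideal_ofMl.
Qed.

End IdealTheory.

(** * Binomials in a lattice ideal *)

Section LatticeIdeals.
Variable n : nat.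
Implicit Types (L M : set 'rV[int]_n) (u v w m : 'X_{1..n}).

Lemma lattice0 L : is_lattice L -> L 0.
Proof. by case=> L0 _; move: L0; rewrite in_setE. Qed.

Lemma latticeB L x y : is_lattice L -> L x -> L y -> L (x - y).
Proof.
by case=> _ subL Lx Ly; have:= subL x y; rewrite !in_setE; apply.
Qed.

Lemma latticeN L x : is_lattice L -> L x -> L (- x).
Proof.
by move=> lL Lx; rewrite -sub0r; apply: latticeB => //; apply: lattice0.
Qed.

Lemma latticeD L x y : is_lattice L -> L x -> L y -> L (x + y).
Proof.
by move=> lL Lx Ly; rewrite -[y]opprK; apply: latticeB => //; apply: latticeN.
Qed.

Lemma is_latticeP L :
  L 0 -> (forall x y, L x -> L y -> L (x - y)) -> is_lattice L.
Proof.
by move=> L0 LB; split=> [|x y]; rewrite !in_setE //; apply: LB.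
Qed.

Lemma multiples_lattice (w : 'rV[int]_n) :
  is_lattice [set v | exists c : int, v = c *: w].
Proof.
apply: is_latticeP => /= [|_ _ [c ->] [d ->]].
  by exists 0; rewrite scale0r.
by exists (c - d); rewrite scalerBl.
Qed.

Lemma exponent_diffxx u : exponent_diff u u = 0.
Proof. by apply/rowP=> i; rewrite !mxE subrr. Qed.

Lemma exponent_diffN u v : - exponent_diff u v = exponent_diff v u.
Proof. by apply/rowP=> i; rewrite !mxE opprB. Qed.

Lemma exponent_diffD u v m :
  exponent_diff u v + exponent_diff v m = exponent_diff u m.
Proof. by apply/rowP=> i; rewrite !mxE addrA subrK. Qed.

Lemma exponent_diff_add2l m u v :
  exponent_diff (m + u)%MM (m + v)%MM = exponent_diff u v.
Proof. by apply/rowP=> i; rewrite !mxE !mnmDE !PoszD; ring. Qed.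

Lemma exponent_diff_sub u v a b : (a <= u)%MM -> (b <= v)%MM ->
  exponent_diff (u - a)%MM (v - b)%MM = exponent_diff u v - exponent_diff a b.
Proof.
move=> /mnm_lepP le_au /mnm_lepP le_bv; apply/rowP=> i.
by rewrite !mxE !mnmBE -!subzn //; ring.
Qed.

(** Positive and negative parts of [x]. *)
Lemma exponent_diff_surj (x : 'rV[int]_n) : exists u v, x = exponent_diff u v.
Proof.
exists [multinom if (0 <= x ord0 i)%R then absz (x ord0 i) else 0%N | i < n],
       [multinom if (0 <= x ord0 i)%R then 0%N else absz (x ord0 i) | i < n].
apply/rowP=> i; rewrite !mxE !mnmE; case: ifP => x_ge0.
  by rewrite gez0_abs // subr0.
by rewrite ltz0_abs ?ltNge ?x_ge0 // sub0r opprK.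
Qed.

Section ClassSums.
Variable k : fieldType.
Implicit Types (f g : {mpoly k[n]}) (P : pred 'X_{1..n}).

(** For [P] the indicator of a congruence class modulo [L], this linear form
    vanishes on the lattice ideal, and so separates the classes. *)
Definition coefficient_sum P f : k := \sum_(m <- msupp f | P m) f@_m.

Lemma coefficient_sum_widen P f (s : seq 'X_{1..n}) :
  uniq s -> {subset msupp f <= s} ->
  coefficient_sum P f = \sum_(m <- s | P m) f@_m.
Proof.
move=> s_uniq sub.
rewrite [RHS](bigID (mem (msupp f))) /= [X in _ + X]big1; last first.
  by move=> m /andP[_]; apply: memN_msupp_eq0.
rewrite addr0 (eq_bigl (fun m => (m \in msupp f) && P m)); last first.
  by move=> m; rewrite andbC.
rewrite -big_filter_cond; apply: perm_big; apply: uniq_perm.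
- exact: msupp_uniq.
- exact: filter_uniq.
- by move=> m; rewrite mem_filter andb_idr // => /sub.
Qed.

Lemma coefficient_sumD P f g :
  coefficient_sum P (f + g) = coefficient_sum P f + coefficient_sum P g.
Proof.
pose s := undup (msupp f ++ msupp g).
have us : uniq s by apply: undup_uniq.
have sf : {subset msupp f <= s}.
  by move=> m mf; rewrite mem_undup mem_cat mf.
have sg : {subset msupp g <= s}.
  by move=> m mg; rewrite mem_undup mem_cat mg orbT.
have sfg : {subset msupp (f + g) <= s}.
  by move=> m /msuppD_le; rewrite mem_undup.
rewrite (coefficient_sum_widen P us sf) (coefficient_sum_widen P us sg).
rewrite (coefficient_sum_widen P us sfg) -big_split /=.
by apply: eq_bigr => m _; rewrite mcoeffD.
Qed.

Lemma coefficient_sum0 P : coefficient_sum P 0 = 0.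
Proof. by rewrite /coefficient_sum msupp0 big_nil. Qed.

Lemma coefficient_sumZ P c f :
  coefficient_sum P (c *: f) = c * coefficient_sum P f.
Proof.
rewrite (coefficient_sum_widen P (msupp_uniq f)); last exact: msuppZ_le.
by rewrite mulr_sumr; apply: eq_bigr => m _; rewrite mcoeffZ.
Qed.

Lemma coefficient_sumX P m : coefficient_sum P 'X_[m] = (P m)%:R.
Proof.
rewrite /coefficient_sum msuppX big_mkcond big_seq1 mcoeffX eqxx.
by case: (P m).
Qed.

Lemma coefficient_sumMX P m f :
  coefficient_sum P ('X_[m] * f) = coefficient_sum (fun m' => P (m + m')%MM) f.
Proof.
rewrite /coefficient_sum mulrC (perm_big _ (msuppMX f m)) /= big_map.
by apply: eq_bigr => m' _; rewrite mcoeffMX.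
Qed.

Lemma coefficient_sumB P f g :
  coefficient_sum P (f - g) = coefficient_sum P f - coefficient_sum P g.
Proof. by rewrite coefficient_sumD -scaleN1r coefficient_sumZ mulN1r. Qed.

(** The polynomials all of whose coefficient sums over [L]-saturated sets of
    exponents vanish form an ideal: multiplying by [X^m] amounts to translating
    the saturated set by [m].  This ideal contains the generators, and the
    sum over the class of [u] then forces [v] to lie in that class.  Quantifying
    over all saturated sets, instead of fixing one class, is what makes the
    condition stable under translation. *)
Lemma lattice_ideal_exponent_diff L u v : is_lattice L ->
  lattice_ideal L ('X_[u] - 'X_[v] : {mpoly k[n]}) -> L (exponent_diff u v).
Proof.
move=> lL Luv.
pose saturated P := forall a b, L (exponent_diff a b) -> P a = P b.
suff vanish f : lattice_ideal L f ->
    forall P, saturated P -> coefficient_sum P f = 0.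
  pose P m := `[< L (exponent_diff u m) >].
  have satP : saturated P.
    move=> a b Lab; apply/asboolP/asboolP => Lu.
      by rewrite -(exponent_diffD _ a); apply: latticeD.
    by rewrite -(exponent_diffD _ b); apply: latticeD => //;
       rewrite -exponent_diffN; apply: latticeN.
  have := vanish _ Luv P satP; rewrite coefficient_sumB !coefficient_sumX.
  have -> : P u by apply/asboolP; rewrite exponent_diffxx; apply: lattice0.
  case: (boolP (P v)) => [/asboolP //|_] /eqP.
  by rewrite subr0 oner_eq0.
suff : lattice_ideal L `<=`
  [set f | forall P, saturated P -> coefficient_sum P f = 0]
  by move=> sub /sub.
apply: ideal_of_min => [|_ [a [b [Lab ->]]] P satP]; first split=> /=.
- by move=> P _; apply: coefficient_sum0.
- by move=> p q p0 q0 P satP; rewrite coefficient_sumD p0 // q0 // addr0.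
- move=> r q q0 P satP; elim/mpolyind: r => [|c m p _ _ IHp].
    by rewrite mul0r coefficient_sum0.
  rewrite mulrDl coefficient_sumD IHp addr0 -scalerAl coefficient_sumZ.
  rewrite coefficient_sumMX q0 ?mulr0 // => a b Lab.
  by apply: satP; rewrite exponent_diff_add2l.
- by rewrite coefficient_sumB !coefficient_sumX (satP a b Lab) subrr.
Qed.

End ClassSums.
End LatticeIdeals.

(** * Binomial generating sets of least cardinality *)

Section GeneratingSequences.
Variables (k : fieldType) (n : nat) (L : set 'rV[int]_n).
Implicit Types (s t : seq {mpoly k[n]}) (f g h : {mpoly k[n]}).
Implicit Types (u v w a b : 'X_{1..n}).

Definition generates s :=
  [set` s] `<=` binomials (n := n) /\ ideal_of [set` s] = lattice_ideal L.

Definition shortest_generating s :=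
  generates s /\ forall t, generates t -> (size s <= size t)%N.

(** The minimal pairs [(a, b)] with [a <> b] and [a - b] in [L] are finite in
    number, and a pair [(u, v)] above such an [(a, b)] reduces to the smaller
    pair [(u - a, v - b)], of which the exponent difference is again in [L]. *)
Lemma lattice_ideal_fg : is_lattice L -> exists s, generates s.
Proof.
move=> lL.
pose G : set ('X_{1..n} * 'X_{1..n}) :=
  [set p | p.1 <> p.2 /\ L (exponent_diff p.1 p.2)].
have [basis [basisG basisP]] :=
  @finite_basis _ (fun p q => le_multinom2 p q) G (@dickson_multinom2 n).
exists [seq 'X_[p.1] - 'X_[p.2] | p <- basis]; split.
  by move=> f /mapP[p /basisG[neq_p _] ->]; exists p.1, p.2.
apply: ideal_of_eq => [f /mapP[p /basisG[_ Lp] ->]|f [u [v [Luv ->]]]].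
  by apply: ideal_of_gen; exists p.1, p.2.
have [N] := ubnP (mdeg u + mdeg v); elim: N => // N IHN in u v Luv *.
move=> ltN; have [->|neq_uv] := eqVneq u v.
  by rewrite subrr; apply: ideal_of0.
have [|[a b] ab_basis /andP[/= le_au le_bv]] := basisP (u, v).
  by split=> //; apply/eqP.
have [/= neq_ab Lab] := basisG _ ab_basis.
have -> : 'X_[u] - 'X_[v] = 'X_[u - a] * ('X_[a] - 'X_[b])
    + 'X_[b] * ('X_[u - a] - 'X_[v - b]) :> {mpoly k[n]}.
  rewrite -[in LHS](submK le_au) -[in LHS](submK le_bv) !mpolyXD; ring.
apply: ideal_ofD; apply: ideal_ofMl.
  by apply: ideal_of_gen; apply/mapP; exists (a, b).
apply: IHN; first by rewrite exponent_diff_sub //; apply: latticeB.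
rewrite -ltnS; apply: leq_trans ltN; rewrite ltnS.
rewrite -[in X in (_ < X)%N](submK le_au) -[in X in (_ < X)%N](submK le_bv).
rewrite !mdegD addnACA -[X in (X < _)%N]addn0 ltn_add2l lt0n addn_eq0 !mdeg_eq0.
by apply/negP => /andP[/eqP a0 /eqP b0]; apply: neq_ab; rewrite a0 b0.
Qed.

Lemma shortest_exists : is_lattice L -> exists s, shortest_generating s.
Proof.
move=> /lattice_ideal_fg[s0 gen0].
have ex : exists m, `[< exists2 s, generates s & size s = m >].
  by exists (size s0); apply/asboolP; exists s0.
case: (ex_minnP ex) => m /asboolP[s gen_s sz_s] min_m.
exists s; split=> // t gen_t; rewrite sz_s.
by apply: min_m; apply/asboolP; exists t.
Qed.

Lemma sub_ideal_gen s t : {subset s <= t} -> [set` s] `<=` ideal_of [set` t].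
Proof. by move=> st f /= /st tf; apply: ideal_of_gen. Qed.

Lemma shortest_irredundant s f :
  shortest_generating s -> f \in s -> ~ ideal_of [set` rem f s] f.
Proof.
move=> [[s_bin s_gen] s_min] fs f_rem.
have : generates (rem f s).
  split=> [g /= /mem_rem/s_bin //|]; rewrite -s_gen; apply: ideal_of_eq.
    by apply: sub_ideal_gen => g; apply: mem_rem.
  move=> g /= gs; have [-> //|neq_gf] := eqVneq g f.
  apply: ideal_of_gen => /=; move: gs.
  by rewrite (perm_mem (perm_to_rem fs)) inE (negPf neq_gf).
move=> /s_min; rewrite size_rem //.
by case: (s) fs => // x s' _ /=; rewrite ltnn.
Qed.

Lemma shortest_exchange s f h : shortest_generating s -> f \in s ->
  binomials h -> ideal_of [set` s] h -> ideal_of [set` h :: rem f s] f ->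
  shortest_generating (h :: rem f s).
Proof.
move=> [[s_bin s_gen] s_min] fs h_bin sh hf.
split; last first.
  move=> t /s_min; rewrite /= size_rem // prednK //.
  by case: (s) fs.
split=> [g /=|]; first by rewrite inE => /predU1P[-> //|/mem_rem/s_bin].
rewrite -s_gen; apply: ideal_of_eq => g /=.
  by rewrite inE => /predU1P[-> //|/mem_rem gs]; apply: ideal_of_gen.
rewrite (perm_mem (perm_to_rem fs)) inE => /predU1P[-> //|g_rem].
by apply: ideal_of_gen; rewrite /= inE g_rem orbT.
Qed.

(** Sequences of least length are compared with arbitrary, possibly infinite,
    sets of generators; an infinite set is at least as large as any sequence. *)
Lemma shortest_cardinality_minimal s :
  shortest_generating s -> cardinality_minimal L [set` s].
Proof.
move=> [[s_bin s_gen] s_min]; split.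
  split=> // T sub_T T_gen; apply/seteqP; split=> // f /= fs.
  apply: contrapT => nTf.
  have TE : T = [set` [seq g <- s | g \in T]].
    apply/seteqP; split=> g /=; rewrite mem_filter; last first.
      by case/andP=> /set_mem.
    by move=> Tg; rewrite mem_set //; apply: sub_T.
  have : generates [seq g <- s | g \in T].
    by split; rewrite -TE // => g /sub_T/s_bin.
  move=> /s_min; rewrite size_filter leqNgt => /negP; apply.
  rewrite ltn_neqAle count_size andbT -all_count; apply/allPn; exists f => //.
  by apply/negP; rewrite in_setE.
move=> T [T_bin T_gen _].
have [/finite_seqP[t TE]|infT] := pselect (finite_set T); last first.
  apply: card_le_trans (proj1 (infiniteP T) infT).
  exact: card_le_trans (card_seq_le s) (card_leT _).
have undupE : [set` undup t] = T.
  by rewrite TE; apply/seteqP; split=> f /=; rewrite mem_undup.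
rewrite -undupE; apply: card_le_trans (card_seq_le s) _.
apply: card_le_trans (card_seq_ge (undup_uniq t)).
by rewrite card_le_II; apply: s_min; split; rewrite undupE.
Qed.

(** With [f = X^a - X^b], the elements [X^(a + j w) - X^b] may each take the
    place of [f]: they differ from it by a multiple of [1 - X^w], which the
    other generators produce. *)
Lemma shortest_infinite s f w : shortest_generating s -> f \in s -> w <> 0%MM ->
  ideal_of [set` rem f s] (1 - 'X_[w]) ->
  infinite_set (universal_markov_basis k L).
Proof.
move=> sh_s fs w_neq0 w_rem.
have [a [b [_ fE]]] : binomials f by apply: sh_s.1.1.
pose h j : {mpoly k[n]} := 'X_[a + w *+ j] - 'X_[b].
have translate j : ideal_of [set` rem f s] ('X_[a] - 'X_[a + w *+ j]).
  exact: ideal_of_translate.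
(* Otherwise f itself would lie in the ideal of the other generators. *)
have neq_b j : (a + w *+ j)%MM <> b.
  move=> ajb; apply: (shortest_irredundant sh_s fs).
  by rewrite [X in ideal_of _ X]fE -{1}ajb.
have shift_inj i j : (a + w *+ i)%MM = (a + w *+ j)%MM -> i = j.
  move=> /(congr1 mdeg); rewrite !mdegD !mdegMn => /addnI/eqP.
  rewrite eqn_pmul2l; first by move/eqP.
  by rewrite lt0n mdeg_eq0; apply/eqP.
have sh_h j : shortest_generating (h j :: rem f s).
  have hE : h j = f - ('X_[a] - 'X_[a + w *+ j]) by rewrite fE /h; ring.
  apply: shortest_exchange => //.
  - by exists (a + w *+ j)%MM, b.
  - rewrite hE; apply: ideal_ofB; first exact: ideal_of_gen.
    apply: (ideal_of_sub _ (translate j)).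
    by apply: sub_ideal_gen => g; apply: mem_rem.
  - rewrite -[X in ideal_of _ X](subrK ('X_[a] - 'X_[a + w *+ j])) -hE.
    apply: ideal_ofD.
      by apply: ideal_of_gen; rewrite /= mem_head.
    apply: (ideal_of_sub _ (translate j)); apply: sub_ideal_gen => g.
    by move=> g_rem; rewrite inE g_rem orbT.
pose F j := [set h j; - h j].
have F_inj : {in [set: nat] &, injective F}.
  move=> i j _ _ Fij; apply: contrapT => neq_ij.
  (* The monomial X^(a + i w) occurs in h i and in neither h j nor - h j. *)
  have hi : (h i)@_(a + w *+ i) = 1.
    by rewrite mcoeffB !mcoeffX eqxx (introF eqP (nesym (neq_b i))) subr0.
  have hj : (h j)@_(a + w *+ i) = 0.
    rewrite mcoeffB !mcoeffX (introF eqP (nesym (neq_b i))) subr0.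
    by rewrite (introF eqP) // => /shift_inj/esym.
  have : F j (h i) by rewrite -Fij; left.
  by case=> hij; move/eqP: hi; rewrite hij ?mcoeffN hj ?oppr0 eq_sym oner_eq0.
apply: (@sub_infinite_set _ (range F)).
  move=> _ [j _ <-]; exists (h j) => //.
  exists [set` h j :: rem f s]; first exact: shortest_cardinality_minimal.
  by rewrite /= mem_head.
by apply/infiniteP; rewrite -(card_le_eql (inj_card_eq F_inj)).
Qed.

(** A binomial without the monomial 1 has constant term zero, and [1 - X^w] is
    not in an ideal generated by such binomials. *)
Lemma generates_unit_binomial s w : generates s -> w <> 0%MM ->
  lattice_ideal L (1 - 'X_[w] : {mpoly k[n]}) ->
  exists2 w', w' <> 0%MM & 1 - 'X_[w'] \in s \/ 'X_[w'] - 1 \in s.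
Proof.
move=> [s_bin s_gen] w_neq0 Lw; apply: contrapT => no_w.
have : (1 - 'X_[w] : {mpoly k[n]})@_0%MM = 0.
  apply: (@constant_term_ideal_of _ _ [set` s]); last by rewrite s_gen.
  move=> g gs; have [a [b [neq_ab gE]]] := s_bin g gs.
  rewrite gE mcoeffB !mcoeffX; have [a0|_] := eqVneq a 0%MM.
    case: no_w; exists b; first by rewrite -a0; apply: nesym.
    by left; rewrite -mpolyX0 -a0 -gE.
  have [b0|_] := eqVneq b 0%MM; last by rewrite subr0.
  case: no_w; exists a; first by rewrite -b0.
  by right; rewrite -mpolyX0 -b0 -gE.
rewrite mcoeffB mcoeff1 mcoeffX eqxx (introF eqP w_neq0) subr0.
by move/eqP; rewrite oner_eq0.
Qed.

(** [1 - X^w] is a binomial of the lattice [Z w], so the ideal of [L] lies in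
    the ideal of [Z w]. *)
Lemma principal_lattice_ideal w :
  lattice_ideal L `<=` ideal_of [set (1 - 'X_[w] : {mpoly k[n]})] ->
  forall x, L x -> exists c : int, x = c *: exponent_diff w 0%MM.
Proof.
move=> Lw x; have [u [v ->]] := exponent_diff_surj x => Luv.
apply: (@lattice_ideal_exponent_diff _ k _ u v (multiples_lattice _)).
have : lattice_ideal L ('X_[u] - 'X_[v] : {mpoly k[n]}).
  by apply: ideal_of_gen; exists u, v.
move/Lw; apply: ideal_of_sub => _ ->; apply: ideal_of_gen.
exists 0%MM, w; rewrite mpolyX0; split=> //.
by exists (-1); rewrite scaleN1r exponent_diffN.
Qed.

End GeneratingSequences.

(** * Rank and pure part *)

Section PurePart.
Variable n : nat.
Implicit Types (L M : set 'rV[int]_n) (x : 'rV[int]_n) (w : 'X_{1..n}).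

(** A matrix with all rows multiples of [x] factors through the row [x]; the
    bound 0 for [x = 0] detects the zero lattice. *)
Lemma lattice_rank_multiples M x :
  (forall y, M y -> exists c : int, y = c *: x) ->
  (lattice_rank M <= (x != 0)%R)%N.
Proof.
move=> Mx; apply/bigmax_leqP => r /asboolP[B [MB B_free]].
have [c cE] := choice (fun i => Mx _ (MB i)).
have BE : B = (\col_i c i) *m x.
  apply/row_matrixP => i; rewrite cE; apply/rowP => j.
  by rewrite !mxE big_ord1 !mxE.
move: B_free; rewrite /row_free BE map_mxM => /eqP rankE.
rewrite -[X in (X <= _)%N]rankE; apply: leq_trans (mxrankM_maxr _ _) _.
have [->|_] := eqVneq x 0; last exact: rank_leq_row.
by rewrite map_mx0 mxrank0.
Qed.

Lemma exponent_diff_nonneg x : (forall i, 0 <= x ord0 i) ->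
  exists w, x = exponent_diff w 0%MM.
Proof.
move=> x_ge0; exists [multinom absz (x ord0 i) | i < n].
by apply/rowP=> i; rewrite !mxE mnmE mnm0E subr0 gez0_abs // ord1.
Qed.

Lemma exponent_diffw0_eq0 w : (exponent_diff w 0%MM == 0) = (w == 0%MM).
Proof.
apply/eqP/eqP => [/rowP w0|->]; last exact: exponent_diffxx.
apply/mnmP=> i; have := w0 i; rewrite !mxE mnm0E subr0.
by case.
Qed.

Lemma pure_part_gen L x : L x -> (forall i, 0 <= x ord0 i) -> pure_part L x.
Proof. by move=> Lx x_ge0; apply: sub_gen_smallest. Qed.

Lemma pure_part_sub L : is_lattice L -> pure_part L `<=` L.
Proof. by move=> lL; apply: smallest_sub => // x []. Qed.

Lemma pure_part_nonzero L : (0 < lattice_rank (pure_part L))%N ->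
  exists2 w, w <> 0%MM & L (exponent_diff w 0%MM).
Proof.
move=> rank_gt0; apply: contrapT => no_w.
have sub : pure_part L `<=` [set v | exists c : int, v = c *: 0].
  apply: smallest_sub; first exact: multiples_lattice.
  move=> x [Lx /exponent_diff_nonneg[w xE]]; exists 0; rewrite scaler0.
  apply/eqP; rewrite xE exponent_diffw0_eq0; apply/eqP.
  apply: contrapT => w_neq0.
  by apply: no_w; exists w => //; rewrite -xE.
by have := lattice_rank_multiples sub; rewrite eqxx leqNgt rank_gt0.
Qed.

Lemma pure_part_cyclic L w : is_lattice L -> L (exponent_diff w 0%MM) ->
  (forall x, L x -> exists c : int, x = c *: exponent_diff w 0%MM) ->
  L = pure_part L.
Proof.
move=> lL Lw Lmult; apply/seteqP; split; last exact: pure_part_sub.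
have pw : pure_part L (exponent_diff w 0%MM).
  by apply: pure_part_gen => // i; rewrite !mxE mnm0E subr0.
have lP : is_lattice (pure_part L).
  apply: is_latticeP => [M [lM _]|x y px py M [lM sM]]; first exact: lattice0.
  by apply: latticeB => //; [apply: px|apply: py].
have natmul_pw j : pure_part L ((j%:Z) *: exponent_diff w 0%MM).
  elim: j => [|j IHj]; first by rewrite scale0r; apply: (lattice0 lP).
  by rewrite intS scalerDl scale1r; apply: (latticeD lP).
move=> _ /Lmult[[] j ->]; first exact: natmul_pw.
by rewrite NegzE scaleNr; apply: (latticeN lP).
Qed.

End PurePart.

Theorem theorem4p19 (k : fieldType) (n : nat) (L : set 'rV[int]_n) :
  is_lattice L ->
  (1 < lattice_rank (pure_part L))%N \/
    (lattice_rank (pure_part L) = 1%N /\ L <> pure_part L) ->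
  infinite_set (universal_markov_basis k L).
Proof.
move=> lL rankL.
have [|w0 w0_neq0 Lw0] := @pure_part_nonzero n L.
  by case: rankL => [/ltnW //|[-> _]].
have [s sh_s] := shortest_exists k lL.
have [|w w_neq0 w_s] := generates_unit_binomial sh_s.1 w0_neq0.
  apply: ideal_of_gen; exists 0%MM, w0; rewrite mpolyX0; split=> //.
  by rewrite -exponent_diffN; apply: latticeN.
have [g gs [w_g g_w]] : exists2 g : {mpoly k[n]}, g \in s &
    ideal_of [set g] (1 - 'X_[w]) /\ ideal_of [set (1 - 'X_[w])] g.
  case: w_s => gs; last exists ('X_[w] - 1) => //.
    by exists (1 - 'X_[w]) => //; split; apply: ideal_of_gen.
  by split; rewrite -[X in ideal_of _ X]opprB; apply: ideal_ofN;
     apply: ideal_of_gen.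
have [/hasP[f fs neq_fg]|/hasPn all_g] := boolP (has (predC1 g) s).
  apply: (shortest_infinite sh_s fs w_neq0).
  apply: ideal_of_sub w_g => _ ->; apply: ideal_of_gen => /=.
  move: gs; rewrite (perm_mem (perm_to_rem fs)) inE eq_sym.
  by rewrite (negPf neq_fg).
have sub_w : lattice_ideal L `<=` ideal_of [set (1 - 'X_[w] : {mpoly k[n]})].
  rewrite -sh_s.1.2; apply: ideal_of_sub => f /= /all_g.
  by rewrite negbK => /eqP->.
have Lmult := principal_lattice_ideal sub_w.
have Lw : L (exponent_diff w 0%MM).
  rewrite -exponent_diffN; apply: latticeN => //.
  apply: (@lattice_ideal_exponent_diff _ k) => //; rewrite mpolyX0 -sh_s.1.2.
  by apply: ideal_of_sub w_g => _ ->; apply: ideal_of_gen.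
case: rankL => [|[_]]; last by case; apply: pure_part_cyclic Lw Lmult.
have := @lattice_rank_multiples _ (pure_part L) (exponent_diff w 0%MM).
move=> /(_ (fun x px => Lmult x (pure_part_sub lL px))) => rank_le.
by rewrite ltnNge (leq_trans rank_le) // leq_b1.
Qed.
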